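(* Let $V$ be a vector space over $\mathbb F$ with finite positive dimension and let $K,K^*$ be a $q$-inverting pair on $V$. Then there exists a unique $\boxtimes_q$-module structure on $V$ such that the generators $x_{02}$ and $x_{13}$ act on $V$ as $K$ and $K^*$ respectively. This module structure is irreducible and of type $1$.
   Context: $\mathbb F$ is an algebraically closed field and $q\in\mathbb F$ is nonzero and not a root of $1$. $\mathbb Z_4=\mathbb Z/4\mathbb Z$, and $[n]_q=(q^n-q^{-n})/(q-q^{-1})$ for $n=0,1,2,\dots$. The $q$-tetrahedron algebra $\boxtimes_q$ is the unital associative $\mathbb F$-algebra with generators $\{x_{rs}\mid r,s\in\mathbb Z_4,\ s-r=1\text{ or }s-r=2\}$ and relations: (i) for $r,s\in\mathbb Z_4$ with $s-r=2$, $x_{rs}x_{sr}=1$; (ii) for $r,s,t\in\mathbb Z_4$ such that $(s-r,t-s)$ is one of $(1,1),(1,2),(2,1)$, $\dfrac{q x_{rs}x_{st}-q^{-1}x_{st}x_{rs}}{q-q^{-1}}=1$; (iii) for $r,s,t,u\in\mathbb Z_4$ with $s-r=t-s=u-t=1$, $x_{rs}^3x_{tu}-[3]_q x_{rs}^2x_{tu}x_{rs}+[3]_q x_{rs}x_{tu}x_{rs}^2-x_{tu}x_{rs}^3=0$. Known fact used to define type: for every finite-dimensional irreducible $\boxtimes_q$-module $V$ there exist an integer $d\ge 0$ and $\varepsilon\in\{1,-1\}$ such that every generator $x_{rs}$ acts semisimply on $V$ with set of eigenvalues $\{\varepsilon q^{d-2i}\mid 0\le i\le d\}$. One calls $d$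 the diameter and $\varepsilon$ the type of $V$. For a nonzero finite-dimensional $\mathbb F$-vector space $V$, a decomposition of $V$ is a sequence $\{V_i\}_{i=0}^d$ of nonzero subspaces with $V=\sum_{i=0}^d V_i$ (direct sum); set $V_{-1}=V_{d+1}=0$. A $q$-inverting pair on $V$ is an ordered pair of invertible linear transformations $K:V\to V$, $K^*:V\to V$ (here $K^*$ is just a name, not an adjoint of $K$) such that: (i) there is a decomposition $\{V_i\}_{i=0}^d$ of $V$ such that for $0\le i\le d$: $(K-q^{d-2i}I)V_i=0$, $K^*V_i\subseteq V_0+V_1+\cdots+V_{i+1}$, and $(K^* )^{-1}V_i\subseteq V_{i-1}+V_i+\cdots+V_d$; (ii) there is a decomposition $\{V_i^*\}_{i=0}^\delta$ of $V$ such that for $0\le i\le\delta$: $(K^*-q^{\delta-2i}I)V_i^*=0$, $KV_i^*\subseteq V_{i-1}^*+V_i^*+\cdots+V_\delta^*$, and $K^{-1}V_i^*\subseteq V_0^*+V_1^*+\cdots+V_{i+1}^*$ (with $V^*_{-1}=V^*_{\delta+1}=0$); (iii) there is no subspace $W\subseteq V$ with $KW\subseteq W$ and $K^*W\subseteq W$ other than $W=0$ and $W=V$. *)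

(* Defs.v *)
From HB Require Import structures.
From mathcomp Require Import all_boot all_order all_algebra.
From mathcomp Require Import boolp.

Set Implicit Arguments.
Unset Strict Implicit.
Unset Printing Implicit Defensive.

Import GRing.Theory.
Local Open Scope ring_scope.
Local Open Scope quotient_scope.

(* The unital associative F-algebra presented by generators g : X and
   relations s = t (for rels s t) is the set of formal expressions modulo the
   least congruence containing the axioms of F-algebras and the relations. *)

Inductive algterm (F X : Type) : Type :=
| TGen of X
| TZero
| TOne
| TOpp of algterm F X
| TAdd of algterm F X & algterm F X
| TMul of algterm F X & algterm F X
| TScale of F & algterm F X.

Arguments TGen {F X}.
Arguments TZero {F X}.
Arguments TOne {F X}.

Declare Scope algterm_scope.
Delimit Scope algterm_scope with AT.
Bind Scope algterm_scope with algterm.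
Notation "0" := TZero : algterm_scope.
Notation "1" := TOne : algterm_scope.
Notation "- s" := (TOpp s) : algterm_scope.
Notation "s + t" := (TAdd s t) : algterm_scope.
Notation "s - t" := (TAdd s (TOpp t)) : algterm_scope.
Notation "s * t" := (TMul s t) : algterm_scope.
Notation "a *: s" := (TScale a%R s) : algterm_scope.

Section PresentedAlgebra.

Variables (F : comNzRingType) (X : Type).
Variable rels : algterm F X -> algterm F X -> Prop.

Inductive algcong : algterm F X -> algterm F X -> Prop :=
| cong_rel s t : rels s t -> algcong s t
| cong_refl s : algcong s s
| cong_sym s t : algcong s t -> algcong t s
| cong_trans s t u : algcong s t -> algcong t u -> algcong s u
| cong_opp s s' : algcong s s' -> algcong (- s) (- s')
| cong_add s s' t t' :
    algcong s s' -> algcong t t' -> algcong (s + t) (s' + t')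
| cong_mul s s' t t' :
    algcong s s' -> algcong t t' -> algcong (s * t) (s' * t')
| cong_scale a s s' : algcong s s' -> algcong (a *: s) (a *: s')
| cong_addA s t u : algcong (s + (t + u)) (s + t + u)
| cong_addC s t : algcong (s + t) (t + s)
| cong_add0 s : algcong (0 + s) s
| cong_addN s : algcong (- s + s) 0
| cong_mulA s t u : algcong (s * (t * u)) (s * t * u)
| cong_mul1l s : algcong (1 * s) s
| cong_mul1r s : algcong (s * 1) s
| cong_mulDl s t u : algcong ((s + t) * u) (s * u + t * u)
| cong_mulDr s t u : algcong (s * (t + u)) (s * t + s * u)
| cong_scaleA a b s : algcong (a *: (b *: s)) ((a * b) *: s)
| cong_scale1 s : algcong (1 *: s) s
| cong_scaleDr a s t : algcong (a *: (s + t)) (a *: s + a *: t)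
| cong_scaleDl s a b : algcong ((a + b) *: s) (a *: s + b *: s)
| cong_scaleAl a s t : algcong (a *: (s * t)) (a *: s * t)
| cong_scaleAr a s t : algcong (a *: (s * t)) (s * (a *: t)).

HB.instance Definition _ := gen_eqMixin (algterm F X).
HB.instance Definition _ := gen_choiceMixin (algterm F X).

Definition algcongb s t : bool := `[< algcong s t >].

Lemma algcongb_refl : reflexive algcongb.
Proof. by move=> s; apply/asboolP/cong_refl. Qed.

Lemma algcongb_sym : symmetric algcongb.
Proof. by move=> s t; apply/asboolP/asboolP; apply: cong_sym. Qed.

Lemma algcongb_trans : transitive algcongb.
Proof.
move=> t s u /asboolP st /asboolP tu; apply/asboolP; exact: cong_trans st tu.
Qed.

Canonical algcong_equiv :=
  EquivRel algcongb algcongb_refl algcongb_sym algcongb_trans.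

Definition presalg : Type := {eq_quot algcong_equiv}.

HB.instance Definition _ := Choice.on presalg.
HB.instance Definition _ := EqQuotient.on presalg.

Definition pres_class (s : algterm F X) : presalg := \pi_presalg s.

Lemma pres_classP s t : reflect (algcong s t) (pres_class s == pres_class t).
Proof. by rewrite /pres_class eqmodE; apply: asboolP. Qed.

Lemma pres_class_eq s t : algcong s t -> pres_class s = pres_class t.
Proof. by move=> st; apply/eqP/pres_classP. Qed.

Lemma pres_class_ind (P : presalg -> Prop) :
  (forall s, P (pres_class s)) -> forall a, P a.
Proof. by move=> Ps a; rewrite -[a]reprK; apply: Ps. Qed.

Lemma repr_class s : algcong (repr (pres_class s)) s.
Proof. by apply/pres_classP; rewrite /pres_class reprK. Qed.

Definition pres_gen (g : X) : presalg := pres_class (TGen g).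
Definition pres_zero : presalg := pres_class 0.
Definition pres_one : presalg := pres_class 1.
Definition pres_opp (a : presalg) : presalg := pres_class (- repr a).
Definition pres_add (a b : presalg) : presalg := pres_class (repr a + repr b).
Definition pres_mul (a b : presalg) : presalg := pres_class (repr a * repr b).
Definition pres_scale (c : F) (a : presalg) : presalg :=
  pres_class (c *: repr a).

Lemma pres_oppE s : pres_opp (pres_class s) = pres_class (- s).
Proof. by apply/pres_class_eq/cong_opp/repr_class. Qed.

Lemma pres_addE s t :
  pres_add (pres_class s) (pres_class t) = pres_class (s + t).
Proof. by apply/pres_class_eq/cong_add; apply: repr_class. Qed.

Lemma pres_mulE s t :
  pres_mul (pres_class s) (pres_class t) = pres_class (s * t).
Proof. by apply/pres_class_eq/cong_mul; apply: repr_class. Qed.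

Lemma pres_scaleE c s : pres_scale c (pres_class s) = pres_class (c *: s).
Proof. by apply/pres_class_eq/cong_scale/repr_class. Qed.

Definition pres_opE := (pres_oppE, pres_addE, pres_mulE, pres_scaleE).

Lemma pres_addA : associative pres_add.
Proof.
elim/pres_class_ind=> s; elim/pres_class_ind=> t; elim/pres_class_ind=> u.
by rewrite !pres_opE; apply/pres_class_eq/cong_addA.
Qed.

Lemma pres_addC : commutative pres_add.
Proof.
elim/pres_class_ind=> s; elim/pres_class_ind=> t.
by rewrite !pres_opE; apply/pres_class_eq/cong_addC.
Qed.

Lemma pres_add0 : left_id pres_zero pres_add.
Proof.
by elim/pres_class_ind=> s; rewrite !pres_opE; apply/pres_class_eq/cong_add0.
Qed.

Lemma pres_addN : left_inverse pres_zero pres_opp pres_add.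
Proof.
by elim/pres_class_ind=> s; rewrite !pres_opE; apply/pres_class_eq/cong_addN.
Qed.

HB.instance Definition _ :=
  GRing.isZmodule.Build presalg pres_addA pres_addC pres_add0 pres_addN.

Lemma pres_mulA : associative pres_mul.
Proof.
elim/pres_class_ind=> s; elim/pres_class_ind=> t; elim/pres_class_ind=> u.
by rewrite !pres_opE; apply/pres_class_eq/cong_mulA.
Qed.

Lemma pres_mul1l : left_id pres_one pres_mul.
Proof.
by elim/pres_class_ind=> s; rewrite !pres_opE; apply/pres_class_eq/cong_mul1l.
Qed.

Lemma pres_mul1r : right_id pres_one pres_mul.
Proof.
by elim/pres_class_ind=> s; rewrite !pres_opE; apply/pres_class_eq/cong_mul1r.
Qed.

Lemma pres_mulDl : left_distributive pres_mul pres_add.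
Proof.
elim/pres_class_ind=> s; elim/pres_class_ind=> t; elim/pres_class_ind=> u.
by rewrite !pres_opE; apply/pres_class_eq/cong_mulDl.
Qed.

Lemma pres_mulDr : right_distributive pres_mul pres_add.
Proof.
elim/pres_class_ind=> s; elim/pres_class_ind=> t; elim/pres_class_ind=> u.
by rewrite !pres_opE; apply/pres_class_eq/cong_mulDr.
Qed.

(* An arbitrary set of relations may force 1 = 0, and algType is restricted to
   nonzero rings: the algebra structure is therefore given by the ring and
   module structures together with pres_scalerAl and pres_scalerAr. *)
HB.instance Definition _ := GRing.Zmodule_isPzRing.Build presalg
  pres_mulA pres_mul1l pres_mul1r pres_mulDl pres_mulDr.

Lemma pres_scaleA a b v :
  pres_scale a (pres_scale b v) = pres_scale (a * b) v.
Proof.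
by elim/pres_class_ind: v => s; rewrite !pres_opE; apply/pres_class_eq/cong_scaleA.
Qed.

Lemma pres_scale1 : left_id 1 pres_scale.
Proof.
by elim/pres_class_ind=> s; rewrite !pres_opE; apply/pres_class_eq/cong_scale1.
Qed.

Lemma pres_scaleDr : right_distributive pres_scale +%R.
Proof.
move=> a; elim/pres_class_ind=> s; elim/pres_class_ind=> t.
by rewrite /GRing.add /= !pres_opE; apply/pres_class_eq/cong_scaleDr.
Qed.

Lemma pres_scaleDl v : {morph pres_scale^~ v : a b / a + b}.
Proof.
elim/pres_class_ind: v => s a b.
by rewrite [RHS]/GRing.add /= !pres_opE; apply/pres_class_eq/cong_scaleDl.
Qed.

HB.instance Definition _ := GRing.Zmodule_isLmodule.Build F presalg
  pres_scaleA pres_scale1 pres_scaleDr pres_scaleDl.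

Lemma pres_scalerAl (a : F) (u v : presalg) : a *: (u * v) = (a *: u) * v.
Proof.
elim/pres_class_ind: u => s; elim/pres_class_ind: v => t.
rewrite /GRing.mul /GRing.scale /= !pres_opE.
exact/pres_class_eq/cong_scaleAl.
Qed.

Lemma pres_scalerAr (a : F) (u v : presalg) : a *: (u * v) = u * (a *: v).
Proof.
elim/pres_class_ind: u => s; elim/pres_class_ind: v => t.
rewrite /GRing.mul /GRing.scale /= !pres_opE.
exact/pres_class_eq/cong_scaleAr.
Qed.

End PresentedAlgebra.

Section QTetrahedron.

Variables (F : fieldType) (q : F).

Definition qnat (n : nat) : F := (q ^+ n - q ^- n) / (q - q^-1).

Definition qtet_arc (r s : 'Z_4) : bool := (s - r == 1) || (s - r == 2%:R).

Definition qtet_index : Type := {rs : 'Z_4 * 'Z_4 | qtet_arc rs.1 rs.2}.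

Definition qtet_index_of (r s : 'Z_4) (rs : qtet_arc r s) : qtet_index :=
  exist (fun p : 'Z_4 * 'Z_4 => qtet_arc p.1 p.2) (r, s) rs.

Local Notation X rs := (TGen (qtet_index_of rs) : algterm F qtet_index).

Inductive qtet_rel :
    algterm F qtet_index -> algterm F qtet_index -> Prop :=
| qtet_rel_inv r s (rs : qtet_arc r s) (sr : qtet_arc s r) :
    s - r = 2%:R ->
    qtet_rel (X rs * X sr) 1
| qtet_rel_qweyl r s t (rs : qtet_arc r s) (st : qtet_arc s t) :
    (s - r, t - s) \in [:: (1, 1); (1, 2%:R); (2%:R, 1)] ->
    qtet_rel
      ((q - q^-1)^-1 *: (q *: (X rs * X st) - q^-1 *: (X st * X rs))) 1
| qtet_rel_qserre r s t u (rs : qtet_arc r s) (tu : qtet_arc t u) :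
    s - r = 1 -> t - s = 1 -> u - t = 1 ->
    qtet_rel
      (X rs * X rs * X rs * X tu
       - qnat 3 *: (X rs * X rs * X tu * X rs)
       + qnat 3 *: (X rs * X tu * X rs * X rs)
       - X tu * X rs * X rs * X rs) 0.

Definition qtet : Type := presalg qtet_rel.

Definition qtet_x (r s : 'Z_4) (rs : qtet_arc r s) : qtet :=
  pres_gen qtet_rel (qtet_index_of rs).

End QTetrahedron.

Section Modules.

Variables (F : fieldType) (V : vectType F).

(* A qtet q-module whose underlying F-vector space is V. *)
Definition module_structure (q : F) (rho : qtet q -> 'End(V)) : Prop :=
  [/\ linear rho, rho 1 = \1%VF & forall a b, rho (a * b) = (rho a \o rho b)%VF].

Definition irreducible_module (q : F) (rho : qtet q -> 'End(V)) : Prop :=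
  fullv != 0%VS :> {vspace V} /\
  forall W : {vspace V},
    (forall a, (rho a @: W <= W)%VS) -> W = 0%VS \/ W = fullv.

Definition semisimple_endo (f : 'End(V)) : Prop :=
  exists2 b : seq V, basis_of fullv b
    & {in b, forall v, exists a : F, f v = a *: v}.

Definition qtet_diameter_type (q : F) (rho : qtet q -> 'End(V))
    (d : nat) (eps : F) : Prop :=
  (eps = 1 \/ eps = -1) /\
  forall (r s : 'Z_4) (rs : qtet_arc r s),
    semisimple_endo (rho (qtet_x q rs)) /\
    (forall a : F, passmx.leigenvalue (rho (qtet_x q rs)) a <->
       exists2 i : nat, (i <= d)%N & a = eps * q ^ (d%:Z - 2 * i%:Z)).

Definition qtet_type (q : F) (rho : qtet q -> 'End(V)) (eps : F) : Prop :=
  exists d : nat, qtet_diameter_type rho d eps.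

Definition decomposition (d : nat) (U : 'I_d.+1 -> {vspace V}) : Prop :=
  [/\ forall i, U i != 0%VS,
      (\sum_i U i)%VS = fullv
    & directv (\sum_i U i)].

(* U_0 + ... + U_(i+1) and U_(i-1) + ... + U_d; an index outside 0..d
   contributes nothing, in accordance with U_(-1) = U_(d+1) = 0. *)
Definition lower_sum (d : nat) (U : 'I_d.+1 -> {vspace V}) (i : 'I_d.+1) :=
  (\sum_(j < d.+1 | (j <= i.+1)%N) U j)%VS.

Definition upper_sum (d : nat) (U : 'I_d.+1 -> {vspace V}) (i : 'I_d.+1) :=
  (\sum_(j < d.+1 | (i <= j.+1)%N) U j)%VS.

(* As K and Ks are bijective, (_^-1)%VF is the genuine inverse. *)
Definition q_inverting_pair (q : F) (K Ks : 'End(V)) : Prop :=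
  [/\ bijective K /\ bijective Ks,
      exists (d : nat) (U : 'I_d.+1 -> {vspace V}),
        decomposition U /\
        forall i : 'I_d.+1,
          [/\ ((K - q ^ (d%:Z - 2 * i%:Z) *: \1%VF) @: U i = 0)%VS,
              (Ks @: U i <= lower_sum U i)%VS
            & (Ks^-1%VF @: U i <= upper_sum U i)%VS],
      exists (delta : nat) (U : 'I_delta.+1 -> {vspace V}),
        decomposition U /\
        forall i : 'I_delta.+1,
          [/\ ((Ks - q ^ (delta%:Z - 2 * i%:Z) *: \1%VF) @: U i = 0)%VS,
              (K @: U i <= upper_sum U i)%VS
            & (K^-1%VF @: U i <= lower_sum U i)%VS]
    & forall W : {vspace V},
        (K @: W <= W)%VS -> (Ks @: W <= W)%VS -> W = 0%VS \/ W = fullv].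

End Modules.

(* Main.v *)
Require Import Defs.
From HB Require Import structures.
From mathcomp Require Import all_boot all_order all_algebra.
From mathcomp Require Import boolp.
From mathcomp Require Import ring zify.
Set Implicit Arguments.
Unset Strict Implicit.
Unset Printing Implicit Defensive.
Import GRing.Theory.
Local Open Scope ring_scope.

(** Write y_r and a_r, for r in Z/4, for the images of x_(r,r+2) and x_(r,r+1):
    the y_r have to be K, Ks, K^-1 and Ks^-1, and the problem is to find the a_r.
    Put p = q^-2.  Relation (ii) for x and y says x y - p y x = 1 - p, which is
    [qweyl_rel p x y].

    Existence of a_r.  Summing the eigenspaces of K and of Ks from either end
    gives four flags F_0, ..., F_3.  On F_r the operator y_r acts triangularly
    with known scalars, and y_(r+1) moves F_r up by at most one step.  Hence for
    each n the spaces C_i = F_r(i+1) :&: F_(r+1)(n+1-i), 0 <= i <= n, are pushed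
    down one index by y_(r+2) and up one index by y_(r+1), modulo scalars, so
    their sum is invariant under K and Ks and is 0 or V.  Comparing sizes for
    varying n shows that the two flags have equal length d and that, for n = d,
    the C_i form a decomposition with no zero part ([split_decomposition]).
    Letting a_r act on C_i by q^(d-2i) gives exactly the relations between a_r
    and y_(r+1), y_(r+2), and the eigenvalues required for type 1.

    Rigidity ([quasi_central_eq0]).  If D commutes with y_(r+2) up to a nonzero
    scalar and with y_(r+1) up to a nonzero scalar that is not a root of unity,
    then D = 0: comparing determinants shows that D is singular, and its kernel is
    invariant under K and Ks, hence is V.  Three applications finish the proof.
    The difference of two candidates for a_r is such a D, which gives uniqueness.
    The defect a_r a_(r+1) - p a_(r+1) a_r - (1 - p) is such a D, which gives the
    case (1,1) of (ii).  The left side of (iii) for a_r and a_(r+2) is such a D,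
    because it is an iterated twisted commutator. *)

(** * Twisted commutators of endomorphisms *)

(** The product is composition; V = 0 is included, so the ring may be trivial. *)
HB.instance Definition _ (F : fieldType) (V : vectType F) :=
  GRing.Zmodule_isPzRing.Build 'End(V)
    (@comp_lfunA F V V V V) (@comp_lfun1l F V V) (@comp_lfun1r F V V)
    (@comp_lfunDl F V V V) (@comp_lfunDr F V V V).

Section TwistedCommutators.

Variables (F : fieldType) (V : vectType F).
Implicit Types (r s t p : F) (u v k x y z w : 'End(V)).

Lemma end_mulE u v e : (u * v) e = u (v e). Proof. exact: comp_lfunE. Qed.
Lemma end_oneE e : (1 : 'End(V)) e = e. Proof. exact: id_lfunE. Qed.
Lemma end_scalerAl t u v : t *: u * v = t *: (u * v).
Proof. by rewrite [RHS]comp_lfunZl. Qed.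
Lemma end_scalerAr t u v : u * (t *: v) = t *: (u * v).
Proof. by rewrite [RHS]comp_lfunZr. Qed.

(** Twisted commutators obey a twisted Leibniz rule ([twM]) and, for a fixed
    first argument, commute with each other ([tw_tw]); this replaces explicit
    normal forms of noncommutative words. *)
Definition tw t k u := k * u - t *: (u * k).

Definition qweyl_rel t x y := tw t x y = (1 - t) *: (1 : 'End(V)).

Lemma twM r s t k u v : s * t = r ->
  tw r k (u * v) = tw s k u * v + s *: (u * tw t k v).
Proof.
move=> <-.
rewrite /tw mulrBl mulrBr scalerBr end_scalerAl end_scalerAr scalerA !mulrA.
by rewrite addrA subrK.
Qed.

Lemma twZ t k c u : tw t k (c *: u) = c *: tw t k u.
Proof.
by rewrite /tw end_scalerAl end_scalerAr scalerBr !scalerA mulrC.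
Qed.

Lemma twB t k u v : tw t k (u - v) = tw t k u - tw t k v.
Proof. by rewrite /tw mulrBr mulrBl scalerBr opprD addrACA opprD. Qed.

Lemma tw1 t k : tw t k 1 = (1 - t) *: k.
Proof. by rewrite /tw mulr1 mul1r scalerBl scale1r. Qed.

Lemma tw_tw s t x u : tw s x (tw t x u) = tw t x (tw s x u).
Proof.
rewrite /tw !mulrBr !mulrBl !end_scalerAl !end_scalerAr.
rewrite !scalerBr !scalerA !mulrA.
by rewrite (mulrC s) !opprB !addrA addrAC [RHS]addrAC (addrAC (x * x * u)).
Qed.

Lemma tw_flip t x y : t != 0 -> tw t x y = - t *: tw t^-1 y x.
Proof.
move=> t0; rewrite /tw scalerBr !scalerA mulNr mulfV //.
by rewrite !scaleNr scale1r opprK addrC.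
Qed.

Lemma qweyl_relC t x y : t != 0 -> qweyl_rel t x y -> qweyl_rel t^-1 y x.
Proof.
move=> t0; rewrite /qweyl_rel (tw_flip _ _ t0) => /(congr1 ( *:%R (- t^-1))).
rewrite !scalerA mulrNN mulVf // scale1r => ->.
by congr (_ *: _); field.
Qed.

(** The relations of an edge operator u involve some y_r directly and others
    only through y_(r+2) = y_r^-1; here they are transported to the inverse. *)
Lemma tw_inverse t k z u : t != 0 -> k * z = 1 -> z * k = 1 ->
  qweyl_rel t k u -> tw t^-1 z u = (1 - t^-1) *: (z * z).
Proof.
move=> t0 kz zk rku.
have <- : z * tw t^-1 u k * z = tw t^-1 z u.
  rewrite /tw mulrBr mulrBl end_scalerAr end_scalerAl.
  by rewrite !mulrA zk mul1r -!mulrA kz mulr1.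
by rewrite (qweyl_relC t0 rku) end_scalerAr end_scalerAl mulr1.
Qed.

Lemma tw_eqP t k u : (tw t k u = 0) <-> (k * u = t *: (u * k)).
Proof.
split; first by move/eqP; rewrite subr_eq0 => /eqP.
by rewrite /tw => ->; rewrite subrr.
Qed.

End TwistedCommutators.

(** * Twisted commutators of the defects of the relations *)

Section QuasiCommutation.
Variables (F : fieldType) (V : vectType F).
Implicit Types (p s : F) (a b k x z w L : 'End(V)).

Lemma tw_sqr s x k :
  qweyl_rel s x k -> tw (s * s) x (k * k) = (1 - s * s) *: k.
Proof.
move=> xk; rewrite (twM _ _ _ (erefl (s * s))) xk end_scalerAl end_scalerAr.
by rewrite mul1r mulr1 scalerA -scalerDl; congr (_ *: _); ring.
Qed.

(** By the Leibniz rule both a b and b a have twisted commutators with k that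
    are multiples of b - a, and the two multiples cancel. *)
Lemma tw_qweyl_defect_source p k a b : p != 0 ->
  qweyl_rel p k a -> qweyl_rel p^-1 k b ->
  tw 1 k (tw p a b - (1 - p) *: (1 : 'End(V))) = 0.
Proof.
move=> p0 ka kb.
have kab : tw 1 k (a * b) = (1 - p) *: (b - a).
  rewrite (twM _ _ _ (mulfV p0)) ka kb end_scalerAl end_scalerAr mul1r mulr1.
  by rewrite scalerA scalerBr -scaleNr; congr (_ + _ *: _); field.
have kba : tw 1 k (b * a) = p^-1 *: ((1 - p) *: (b - a)).
  rewrite (twM _ _ _ (mulVf p0)) ka kb end_scalerAl end_scalerAr mul1r mulr1.
  rewrite addrC !scalerA scalerBr -scaleNr.
  by congr (_ + _ *: _); field.
rewrite twB twZ tw1 subrr scale0r scaler0 subr0.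
rewrite [X in tw 1 k X]/tw twB twZ kab kba.
by rewrite scalerA mulfV // scale1r subrr.
Qed.

(** The commutators of L with a b and with b a produce the quadratic terms
    a L L and L L a; these recombine, by [tw_sqr], into a multiple of L that
    matches the contribution of the constant 1 - p. *)
Lemma tw_qweyl_defect_target p L a b : p != 0 ->
  qweyl_rel p^-1 L a -> tw p^-1 L b = (1 - p^-1) *: (L * L) ->
  tw (p^-1 * p^-1) L (tw p a b - (1 - p) *: (1 : 'End(V))) = 0.
Proof.
move=> p0 La Lb; have pV0 : p^-1 != 0 by rewrite invr_neq0.
have aL : qweyl_rel p a L by rewrite -[p]invrK; apply: qweyl_relC.
have aLL : a * (L * L) = (p * p) *: (L * L * a) + (1 - p * p) *: L.
  by rewrite -(tw_sqr aL) /tw addrC subrK.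
rewrite twB twZ tw1 [X in tw _ L X]/tw twB twZ.
rewrite !(twM _ _ _ (erefl (p^-1 * p^-1))) La Lb !end_scalerAl !end_scalerAr.
rewrite !mul1r !mulr1 aLL !(scalerDr, scalerA) opprD !addrA.
rewrite [X in X - _ = 0]addrAC -!scaleNr.
(* Collect the coefficients of b, of L L a and of L; each of them vanishes. *)
set u := L * L * a.
rewrite (ACl ((1 * 4) * (2 * 5) * (3 * 6)))%AC /= -!scalerDl.
rewrite [X in X *: b](_ : _ = 0); last by field.
rewrite [X in X *: u](_ : _ = 0); last by field.
rewrite [X in X *: L](_ : _ = 0); last by field.
by rewrite !scale0r !addr0.
Qed.

(** The cubic q-Serre expression, in the factored form that makes its twisted
    commutators computable; [serre_opE] expands it. *)
Definition serre_op p x w := tw p^-1 x (tw 1 x (tw p x w)).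

Lemma serre_opC p x w : serre_op p^-1 x w = serre_op p x w.
Proof.
by rewrite /serre_op invrK (tw_tw p 1) (tw_tw p p^-1) (tw_tw 1 p^-1).
Qed.

Lemma serre_opE p x w : p != 0 ->
  serre_op p x w = x * x * x * w - (1 + p + p^-1) *: (x * x * w * x)
                   + (1 + p + p^-1) *: (x * w * x * x) - w * x * x * x.
Proof.
move=> p0; rewrite /serre_op /tw.
rewrite !(mulrBl, mulrBr, scalerBr, end_scalerAl, end_scalerAr).
rewrite !scale1r !scalerA !mulrA !scalerDl !opprB !opprD !scale1r mulVf //.
rewrite scale1r !addrA.
by rewrite (ACl (1*4*2*8*7*3*5*6))%AC /= scale1r.
Qed.

(** When s t = 1, the constant part of the relation between k and x drops out,
    so a twisted commutator with x is carried to another one. *)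
Lemma tw_mul_tw p s t r k x u : p != 0 -> s * t = 1 -> p * t = r ->
  qweyl_rel p k x -> tw r k (tw s x u) = p *: tw r^-1 x (tw t k u).
Proof.
move=> p0 st1 <- kx; rewrite [X in tw _ k X]/tw twB twZ.
rewrite (twM _ _ _ (erefl (p * t))) (twM _ _ _ (mulrC t p)) kx.
rewrite !end_scalerAl !end_scalerAr mul1r mulr1.
have t0 : t != 0.
  by apply: contra_eq_neq st1 => ->; rewrite mulr0 eq_sym oner_neq0.
have -> : s = t^-1 by apply: (mulIf t0); rewrite st1 mulVf.
set v := tw t k u; rewrite scalerDr !scalerA mulKf //.
rewrite /tw scalerBr scalerA invfM mulVKf //.
by rewrite [t^-1 *: _ + _]addrC opprD addrA [_ + p *: _]addrC addrK.
Qed.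

(** Three applications of [tw_mul_tw] turn the Serre expression in w into an
    iterated twisted commutator of x with k k.  The factors commute, and taken in
    a suitable order they lower the degree in k from 2 to 1 to 0, where the last
    one is an ordinary commutator with 1. *)
Lemma tw_serre_op p k x w : p != 0 ->
  qweyl_rel p k x -> tw p^-1 k w = (1 - p^-1) *: (k * k) ->
  tw (p * p) k (serre_op p x w) = 0.
Proof.
move=> p0 kx kw; have xk := qweyl_relC p0 kx.
rewrite /serre_op (tw_mul_tw _ p0 (mulVf p0) (erefl _) kx).
rewrite (tw_mul_tw _ p0 (mulr1 1) (mulr1 p) kx).
rewrite (tw_mul_tw _ p0 (mulfV p0) (mulfV p0) kx) invr1 kw !twZ.
rewrite (tw_tw p^-1) (tw_tw (p * p)^-1 1) (tw_tw (p * p)^-1 p^-1).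
rewrite invfM (tw_sqr xk).
by rewrite !twZ xk !twZ tw1 subrr scale0r !scaler0.
Qed.

End QuasiCommutation.

(** * Rigidity with respect to an irreducible pair *)

Section IrreduciblePairs.

Import passmx.

Variables (F : fieldType) (V : vectType F).
Implicit Types (K L X Y Z D f g : 'End(V)) (U W : {vspace V}).

Definition irreducible_pair X Y := forall W : {vspace V},
  (X @: W <= W)%VS -> (Y @: W <= W)%VS -> W = 0%VS \/ W = fullv.

Lemma limg_subvP f U W :
  (forall v, v \in U -> f v \in W) <-> (f @: U <= W)%VS.
Proof.
split=> [fW | /subvP fW v Uv]; last exact/fW/memv_img.
by apply/subvP=> _ /memv_imgP[v Uv ->]; apply: fW.
Qed.

Lemma irreducible_pairC X Y : irreducible_pair X Y -> irreducible_pair Y X.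
Proof. by move=> irr W YW XW; apply: irr. Qed.

Lemma limg_inverse f g W : f * g = 1 -> g * f = 1 ->
  (f @: W <= W)%VS -> (g @: W <= W)%VS.
Proof.
move=> fg gf fW; have kf : lker f == 0%VS.
  by apply/lker0P/(can_inj (g := g)) => v; rewrite -end_mulE gf end_oneE.
have /eqP fWE : (f @: W == W)%VS.
  by rewrite eqEdim fW limg_dim_eq ?leqnn // (eqP kf) capv0.
by rewrite -[X in (g @: X <= _)%VS]fWE -limg_comp [(_ \o _)%VF]gf lim1g.
Qed.

Lemma irreducible_pair_inverse X X' Y : X * X' = 1 -> X' * X = 1 ->
  irreducible_pair X Y -> irreducible_pair X' Y.
Proof.
by move=> XX' X'X irr W X'W YW; apply: irr => //; apply: limg_inverse X'W.
Qed.

(** If D were invertible, L D = b D L would give det L = b^n det L, where n is the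
    dimension of V, and b would be a root of unity. *)
Lemma lker_quasi_central L Z D b : (0 < \dim {:V})%N ->
  L * Z = 1 -> (forall n, (0 < n)%N -> b ^+ n != 1) ->
  tw b L D = 0 -> lker D != 0%VS.
Proof.
move=> V0 LZ bn1 LD; apply/negP=> /lker0_compfV DV.
pose M := mxof (vbasis {:V}) (vbasis {:V}).
have eB := vbasisP {:V}.
have detM f g : \det (M (f * g)) = \det (M f) * \det (M g).
  by rewrite /M (mxof_comp _ _ eB) det_mulmx mulrC.
have det_unit f g : f * g = 1 -> \det (M f) != 0.
  move=> /(congr1 (fun h => \det (M h))); rewrite detM.
  rewrite [M 1]mxof1 ?(basis_free eB) // det1 => fg.
  by apply: contra_eq_neq fg => ->; rewrite mul0r eq_sym oner_neq0.
move/tw_eqP/(congr1 (fun h => \det (M h))): LD.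
rewrite detM /M linearZ /= -/M detZ detM -[LHS]mul1r [\det (M D) * _]mulrC.
move/(mulIf (mulf_neq0 (det_unit _ _ LZ) (det_unit _ _ DV))) => /esym/eqP.
exact/negP/bn1.
Qed.

(** The kernel of D is invariant under k and L, so it is 0 or V, and
    [lker_quasi_central] excludes 0. *)
Lemma quasi_central_eq0 k L Z D a b : (0 < \dim {:V})%N ->
  irreducible_pair k L -> L * Z = 1 ->
  a != 0 -> b != 0 -> (forall n, (0 < n)%N -> b ^+ n != 1) ->
  tw a k D = 0 -> tw b L D = 0 -> D = 0.
Proof.
move=> V0 irr LZ a0 b0 bn1 kD LD.
have kerD0 := lker_quasi_central V0 LZ bn1 LD.
have ker_inv c f : c != 0 -> tw c f D = 0 -> (f @: lker D <= lker D)%VS.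
  move=> c0 /tw_eqP fD; apply/limg_subvP => v; rewrite !memv_ker => /eqP Dv.
  rewrite -end_mulE -[D * f]scale1r -(mulVf c0) -scalerA -fD.
  by rewrite scale_lfunE end_mulE Dv !linear0.
have [ker0 | kerT] := irr _ (ker_inv _ _ a0 kD) (ker_inv _ _ b0 LD).
  by rewrite ker0 eqxx in kerD0.
by apply/lfunP=> v; apply/eqP; rewrite lfunE /= -memv_ker kerT memvf.
Qed.

End IrreduciblePairs.

(** * Weighted decompositions and their flags *)

Section WeightedDecompositions.

Variables (F : fieldType) (V : vectType F) (q : F).
Hypothesis q0 : q != 0.
Implicit Types (Y Z f : 'End(V)).

Definition qweight (d i : nat) : F := q ^ (d%:Z - 2 * i%:Z).

Lemma qweight_neq0 d i : qweight d i != 0.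
Proof. exact: expfz_neq0. Qed.

Lemma qweightS d i : qweight d i.+1 = q ^- 2 * qweight d i.
Proof.
rewrite -[q ^- 2]/(q ^ (- 2%:Z)) -expfzDr //; congr (q ^ _).
by rewrite intS; ring.
Qed.

Lemma qweight_rev d i : (i <= d)%N -> qweight d (d - i) = (qweight d i)^-1.
Proof.
move=> id; rewrite /qweight invr_expz; congr (q ^ _).
by rewrite -subzn //; ring.
Qed.

Definition has_qspectrum d f := semisimple_endo f /\
  forall a : F, passmx.leigenvalue f a <->
    exists2 i : nat, (i <= d)%N & a = qweight d i.

Lemma decomposition_qspectrum d (U : 'I_d.+1 -> {vspace V}) f :
  decomposition U -> (forall i v, v \in U i -> f v = qweight d i *: v) ->
  has_qspectrum d f.
Proof.
move=> [U0 Usum Udir] fU; split.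
  exists (\big[cat/[::]]_i vbasis (U i)).
    by rewrite -Usum; apply: bigcat_basis => // i _; apply: vbasisP.
  move=> v; pose P (s : seq V) := forall v, v \in s -> exists a, f v = a *: v.
  suff: P (\big[cat/[::]]_i vbasis (U i)) by apply.
  apply: (big_ind P) => // [s t Ps Pt u|i _ u]; last first.
    by move/vbasis_mem/fU->; eexists.
  by rewrite mem_cat => /orP[/Ps|/Pt].
move=> a; split=> [|[i id ->]].
  rewrite /passmx.leigenvalue -vpick0; set v := vpick _ => v0.
  have /eqP : (f - a *: \1%VF) v == 0 by rewrite -memv_ker memv_pick.
  have := memvf v; rewrite -Usum => /memv_sumP[us Uus vE].
  rewrite vE linear_sum /= => /(directv_sum_independent Udir).
  have fa i : (f - a *: \1%VF) (us i) = (qweight d i - a) *: us i.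
    by rewrite !lfun_simp (fU i) ?Uus // scalerBl.
  have [i usi|us0] := pickP (fun i => us i != 0); last first.
    by case/eqP: v0; rewrite vE big1 // => i _; apply/eqP/negbFE/us0.
  move/(_ _ i isT) => fus; exists i; first by rewrite -ltnS.
  have /eqP: (f - a *: \1%VF) (us i) = 0.
    by apply: fus => // j _; rewrite fa memvZ ?Uus.
  by rewrite fa scaler_eq0 (negPf usi) orbF subr_eq0 => /eqP.
pose j : 'I_d.+1 := Ordinal (id : (i < d.+1)%N).
apply: contra (U0 j); rewrite -!subv0 => /(subv_trans _) -> //.
apply/subvP=> v Uv; rewrite memv_ker !lfun_simp (fU j) //.
by rewrite -scalerBl subrr scale0r.
Qed.

(** One half of the data of a q-inverting pair, with Z' standing for the inverse
    of Z.  The two halves are this condition for (K, Ks) and for (Ks, K^-1). *)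
Definition filtered_decomposition d Y Z Z' :=
  exists2 U : 'I_d.+1 -> {vspace V}, decomposition U &
    forall i : 'I_d.+1, [/\ forall v, v \in U i -> Y v = qweight d i *: v,
      (Z @: U i <= lower_sum U i)%VS & (Z' @: U i <= upper_sum U i)%VS].

(** Reading the decomposition backwards inverts the weights and exchanges upper
    and lower sums; it supplies the flags attached to K^-1 and Ks^-1. *)
Lemma filtered_decomposition_rev d Y Y' Z Z' : Y' * Y = 1 ->
  filtered_decomposition d Y Z Z' -> filtered_decomposition d Y' Z' Z.
Proof.
move=> Y'Y [U [U0 Usum Udir] YU].
have sum_rev (P : pred 'I_d.+1) :
    (\sum_(j | P j) U j = \sum_(j | P (rev_ord j)) U (rev_ord j))%VS.
  exact: (reindex_inj rev_ord_inj).
exists (fun i => U (rev_ord i)); first split=> [i| |].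
- exact: U0.
- by rewrite -Usum [RHS]sum_rev.
- apply/directv_sum_independent=> us Uus us0 i _; rewrite -[i]rev_ordK.
  apply: (directv_sum_independent Udir (fun j => us (rev_ord j))) => // [j _|].
    by rewrite -{2}[j]rev_ordK Uus.
  by rewrite -[RHS]us0 [RHS](reindex_inj rev_ord_inj).
move=> i; have [YUi ZU Z'U] := YU (rev_ord i); split.
- move=> v Uv; apply: (scalerI (qweight_neq0 d (rev_ord i))).
  rewrite -linearZ /= -YUi // -end_mulE Y'Y end_oneE scalerA /= subSS.
  by rewrite qweight_rev ?mulVf ?scale1r ?qweight_neq0 // -ltnS.
- apply: subv_trans Z'U _; rewrite /upper_sum sum_rev.
  rewrite (eq_bigl (fun j : 'I_d.+1 => (j <= i.+1)%N)) // => j /=.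
  by move: (ltn_ord i) (ltn_ord j); lia.
apply: subv_trans ZU _; rewrite /lower_sum sum_rev.
rewrite (eq_bigl (fun j : 'I_d.+1 => (i <= j.+1)%N)) // => j /=.
by move: (ltn_ord i) (ltn_ord j); lia.
Qed.

(** The index is shifted by one so that A 0 = 0 can serve as the space below the
    lowest step and no boundary case arises: for a decomposition U,
    A i.+1 is U_0 + ... + U_i. *)
Record weighted_flag d (A : nat -> {vspace V}) Y Z : Prop := WeightedFlag {
  wflag0 : A 0%N = 0%VS;
  wflag1 : A 1%N != 0%VS;
  wflag_proper : A d != fullv;
  wflag_full : A d.+1 = fullv;
  wflagS : forall i, (A i <= A i.+1)%VS;
  wflag_weight : forall i v, v \in A i.+1 -> Y v - qweight d i *: v \in A i;
  wflag_shift : forall i v, v \in A i -> Z v \in A i.+1 }.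

Lemma weighted_flag_of_decomposition d Y Z Z' :
  filtered_decomposition d Y Z Z' -> exists A, weighted_flag d A Y Z.
Proof.
move=> [U [U0 Usum Udir] YU].
pose A n := (\sum_(j < d.+1 | (j < n)%N) U j)%VS.
have UA (j : 'I_d.+1) n : (j < n)%N -> (U j <= A n)%VS.
  by move=> jn; apply: (sumv_sup j).
have A_le m n : (m <= n)%N -> (A m <= A n)%VS.
  by move=> mn; apply/subv_sumP=> j jm; apply/UA/(leq_trans jm).
exists A; split.
- by rewrite /A big_pred0.
- by apply: contra (U0 ord0); rewrite -!subv0; apply/subv_trans/UA.
- apply: contra (U0 ord_max) => /eqP AT; rewrite -subv0.
  rewrite -(directv_sumP Udir ord_max isT) subv_cap subvv /=.
  apply: subv_trans (subvf _) _; rewrite -AT; apply/subv_sumP=> j jd.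
  by apply: (sumv_sup j); rewrite // -val_eqE /= neq_ltn jd.
- by rewrite -Usum; apply: eq_bigl => j; rewrite ltn_ord.
- by move=> i; apply: A_le.
- move=> i v /memv_sumP[us Uus ->].
  rewrite linear_sum scaler_sumr -sumrB /=; apply: memv_suml => j ji.
  have [YUj _ _] := YU j; rewrite YUj ?Uus // -scalerBl.
  have [jE | j_lt] := eqVneq (j : nat) i.
    by rewrite jE subrr scale0r mem0v.
  by apply/memvZ/(subvP (UA j i _))/Uus => //; rewrite ltn_neqAle j_lt -ltnS.
move=> i v /memv_sumP[us Uus ->].
rewrite linear_sum /=; apply: memv_suml => j ji.
have [_ /limg_subvP ZUj _] := YU j.
apply/(subvP _ _ (ZUj _ (Uus j ji)))/subv_sumP => k kj; apply: UA; lia.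
Qed.

End WeightedDecompositions.

(** * The split decomposition of two opposite flags *)

Section SplitDecomposition.

Variables (F : fieldType) (V : vectType F) (q : F).
Hypothesis q0 : q != 0.
Variables (X y Y : 'End(V)).
Hypotheses (Xy : X * y = 1) (yX : y * X = 1).
Hypothesis irr : irreducible_pair X Y.
Variables (d e : nat) (A B : nat -> {vspace V}).
Hypothesis flagA : weighted_flag q d A y Y.
Hypothesis flagB : weighted_flag q e B Y X.
Local Notation wt := (qweight q).

Lemma wflag_mono c (C : nat -> {vspace V}) f g : weighted_flag q c C f g ->
  {homo C : m n / (m <= n)%N >-> (m <= n)%VS}.
Proof.
by move=> fC; apply: homo_leq (wflagS fC); [apply: subvv|apply: subv_trans].
Qed.

Lemma wflag_stable c (C : nat -> {vspace V}) f g i v :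
  weighted_flag q c C f g -> v \in C i -> f v \in C i.
Proof.
move=> fC; case: i => [|i] Cv.
  by move: Cv; rewrite (wflag0 fC) !memv0 => /eqP->; rewrite linear0.
rewrite -[f v](subrK (wt c i *: v)) memvD ?memvZ //.
exact/(subvP (wflagS fC i))/(wflag_weight fC).
Qed.

Lemma wflag_full_lt c (C : nat -> {vspace V}) f g i : weighted_flag q c C f g ->
  C i = fullv -> (c < i)%N.
Proof.
move=> fC CiT; rewrite ltnNge; apply/negP => ic; case/eqP: (wflag_proper fC).
by apply/eqP; rewrite eqEsubv subvf -CiT (wflag_mono fC).
Qed.

(** As y stabilizes A i.+1, so does its inverse X, and applying X to
    y w - c w, with w = X v, exchanges c and its inverse. *)
Lemma inverse_lowers_flag i v :
  v \in A i.+1 -> X v - (wt d i)^-1 *: v \in A i.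
Proof.
move=> Av.
have AX : X v \in A i.+1.
  have yA : (y @: A i.+1 <= A i.+1)%VS.
    by apply/limg_subvP=> u; apply: (wflag_stable flagA).
  exact: (limg_subvP _ _ _).2 (limg_inverse yX Xy yA) _ Av.
have := memvZ (- (wt d i)^-1) (wflag_weight flagA AX).
rewrite -end_mulE yX end_oneE scalerBr scalerA mulNr mulVf ?qweight_neq0 //.
by rewrite !scaleNr scale1r opprK addrC.
Qed.

(** Natural subtraction makes the part with index n.+1 equal to 0, which is why
    sums over all i <= n need no separate treatment in [split_sum_dichotomy]. *)
Definition split_part n i := (A i.+1 :&: B (n.+1 - i))%VS.
Local Notation C := split_part.

Lemma split_part_last n : C n n.+1 = 0%VS.
Proof. by rewrite /C subnn (wflag0 flagB) capv0. Qed.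

Lemma split_part_down n i v : (i <= n)%N -> v \in C n i ->
  X v - (wt d i)^-1 *: v \in (A i :&: B (n.+2 - i))%VS.
Proof.
move=> ilen; rewrite !memv_cap => /andP[Av Bv].
rewrite inverse_lowers_flag //= subSn ?leqW //.
by rewrite memvB ?(wflag_shift flagB) // memvZ // (subvP (wflagS flagB _)).
Qed.

Lemma split_part_up n i v : (i <= n)%N -> v \in C n i ->
  Y v - wt e (n - i) *: v \in C n i.+1.
Proof.
move=> ilen; rewrite !memv_cap => /andP[Av]; rewrite subSn // subSS => Bv.
rewrite (wflag_weight flagB) // andbT memvB ?(wflag_shift flagA) //.
by rewrite memvZ // (subvP (wflagS flagA _)).
Qed.

(** X moves a part to the previous one and Y to the next one, up to scalars, so
    the sum of the first m parts is invariant as soon as part m vanishes. *)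
Lemma split_sum_dichotomy n m : (m <= n.+1)%N -> C n m = 0%VS ->
  let S := (\sum_(i < m) C n i)%VS in S = 0%VS \/ S = fullv.
Proof.
move=> mn Cm S.
have CS i : (i < m)%N -> (C n i <= S)%VS.
  by move=> im; apply: (sumv_sup (Ordinal im)).
have step (f : 'End(V)) : (forall i v, (i < m)%N -> v \in C n i -> f v \in S) ->
    (f @: S <= S)%VS.
  move=> fS; apply/limg_subvP=> _ /memv_sumP[us Cus ->].
  by rewrite linear_sum memv_suml //= => i _; apply: (fS i) => //; apply: Cus.
have via_scalar f i a v : (i < m)%N -> v \in C n i ->
    f v - a *: v \in S -> f v \in S.
  move=> im Cv fv; rewrite -[f v](subrK (a *: v)) memvD // memvZ //.
  exact: (subvP (CS i im)).
apply: irr; apply: step => i v im Cv.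
  have ilen : (i <= n)%N by rewrite -ltnS (leq_trans im).
  apply: (via_scalar _ _ (wt d i)^-1 _ im Cv); have := split_part_down ilen Cv.
  case: i im {ilen Cv} => [|i] im.
    by rewrite (wflag0 flagA) cap0v memv0 => /eqP->; rewrite mem0v.
  by apply/subvP/(CS i (ltnW im)).
have ilen : (i <= n)%N by rewrite -ltnS (leq_trans im).
apply: (via_scalar _ _ (wt e (n - i)) _ im Cv); have := split_part_up ilen Cv.
have [im1 | mi] := ltnP i.+1 m; first by apply/subvP/CS.
have -> : i.+1 = m by apply/eqP; rewrite eqn_leq im.
by rewrite Cm memv0 => /eqP->; rewrite mem0v.
Qed.

(** A nonzero part makes the sum of all parts equal to V, yet this sum lies in
    A n.+1 and in B n.+1. *)
Lemma split_part_neq0 n i :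
  (i <= n)%N -> C n i != 0%VS -> (d <= n)%N /\ (e <= n)%N.
Proof.
move=> ilen Ci.
have [S0|ST] := split_sum_dichotomy (leqnn _) (split_part_last n).
  case/negP: Ci; rewrite -subv0 -S0.
  by apply: (sumv_sup (Ordinal (ilen : (i < n.+1)%N))).
have full f g c D : weighted_flag q c D f g ->
    (forall j, (j <= n)%N -> (C n j <= D n.+1)%VS) -> (c <= n)%N.
  move=> fD CD; rewrite -ltnS; apply: (wflag_full_lt fD); apply/eqP.
  rewrite eqEsubv subvf -ST; apply/subv_sumP => j _; apply: CD.
  by rewrite -ltnS.
split; [apply: (full _ _ _ _ flagA)|apply: (full _ _ _ _ flagB)] => j jn.
  by apply: subv_trans (capvSl _ _) _; rewrite (wflag_mono flagA).
by apply: subv_trans (capvSr _ _) _; rewrite (wflag_mono flagB) // leq_subr.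
Qed.

(** Some part is nonzero for n = d, namely the lowest step of B, and some part is
    nonzero for n = e, namely the lowest step of A. *)
Lemma split_diameters : d = e.
Proof.
have Cd : C d d != 0%VS.
  by rewrite /C (wflag_full flagA) subSn // subnn capfv (wflag1 flagB).
have Ce : C e 0 != 0%VS.
  by rewrite /C subn0 (wflag_full flagB) capvf (wflag1 flagA).
apply/eqP; rewrite eqn_leq; apply/andP; split.
  by have [] := split_part_neq0 (leq0n _) Ce.
by have [] := split_part_neq0 (leqnn _) Cd.
Qed.

(** A vanishing part would make the sum of the parts before it equal to V although
    it lies in a proper step of A.  In a vanishing sum of vectors the nonzero term
    of largest index would lie in a nonzero part for n = d - 1. *)
Lemma split_decomposition : decomposition (fun i : 'I_d.+1 => C d i).
Proof.
have C0 : C d 0 != 0%VS.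
  by rewrite /C subn0 split_diameters (wflag_full flagB) capvf (wflag1 flagA).
have C0S m : (0 < m)%N -> (\sum_(i < m) C d i)%VS != 0%VS.
  move=> m0; apply: contra C0; rewrite -!subv0; apply: subv_trans.
  by apply: (sumv_sup (Ordinal m0)).
split=> [i||].
- apply/negP=> /eqP Ci; have i0 : (0 < i)%N.
    by case: (posnP i) => // i0; rewrite -i0 Ci eqxx in C0.
  have [/eqP|ST] := split_sum_dichotomy (ltnW (ltn_ord i)) Ci.
    exact/negP/C0S.
  suff : (d < i)%N by rewrite ltnNge -ltnS ltn_ord.
  apply: (wflag_full_lt flagA); apply/eqP; rewrite eqEsubv subvf -ST.
  apply/subv_sumP => j _; apply: subv_trans (capvSl _ _) _.
  by rewrite (wflag_mono flagA).
- by have [/eqP|] := split_sum_dichotomy (leqnn _) (split_part_last d);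
    rewrite ?(negPf (C0S _ _)).
apply/directv_sum_independent=> us Cus us0.
have [i0 usi0|noi] := pickP (fun i => us i != 0); last first.
  by move=> i _; apply/eqP/negbFE/noi.
have [i usi imax] :=
  @arg_maxnP _ i0 (fun i => us i != 0) (fun i : 'I_d.+1 => val i) usi0.
have := Cus i isT; rewrite memv_cap => /andP[_ Bi].
have Ai : us i \in A i.
  move/eqP: us0; rewrite (bigD1 i) //= addr_eq0 => /eqP->.
  rewrite memvN memv_suml // => j ji.
  have [->|usj] := eqVneq (us j) 0; first exact: mem0v.
  have jlti : (j < i)%N by rewrite ltn_neqAle ji; apply: imax.
  have := Cus j isT; rewrite memv_cap => /andP[Aj _].
  exact: (subvP (wflag_mono flagA jlti)).
case: i usi {imax} Bi Ai => [[|i] /= id] usi Bi Ai.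
  by move: Ai; rewrite (wflag0 flagA) memv0 (negPf usi).
have ilen : (i <= d.-1)%N by lia.
have Ci : C d.-1 i != 0%VS.
  apply: contra usi => /eqP Ci; rewrite -memv0 -Ci memv_cap Ai /=.
  by move: Bi; rewrite prednK ?subSS //; lia.
by have [dd _] := split_part_neq0 ilen Ci; lia.
Qed.

End SplitDecomposition.

(** * Operators diagonal on a decomposition *)

Section DiagonalOperators.

Variables (F : fieldType) (V : vectType F).
Implicit Types (f g : 'End(V)).

Lemma decomposition_diagonal d (U : 'I_d.+1 -> {vspace V}) (c : 'I_d.+1 -> F) :
  decomposition U ->
  exists f : 'End(V), forall i v, v \in U i -> f v = c i *: v.
Proof.
move=> [_ Usum Udir]; pose pr := sumv_pi_for (esym Usum).
exists (\sum_i c i *: pr i) => i v Uv.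
have prv j : pr j v = if j == i then v else 0.
  have sum_v : \sum_k (if k == i then v else 0) = v.
    by rewrite -big_mkcond big_pred1_eq.
  have /eqP := sumv_pi_sum (esym Usum) (memvf v); rewrite -[X in _ == X]sum_v.
  rewrite (directv_sum_unique Udir) => [/forallP/(_ j)/eqP//|k _|k _].
    exact: memv_sum_pi.
  by case: eqP => [->|_] //; apply: mem0v.
rewrite sum_lfunE (bigD1 i) //= big1 ?addr0 => [|j ji].
  by rewrite scale_lfunE prv eqxx.
by rewrite scale_lfunE prv (negPf ji) scaler0.
Qed.

Lemma decomposition_ext d (U : 'I_d.+1 -> {vspace V}) f g :
  decomposition U -> (forall i v, v \in U i -> f v = g v) -> f = g.
Proof.
move=> [_ Usum _] fg; apply/lfunP=> v.
have := memvf v; rewrite -Usum => /memv_sumP[us Uus ->].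
by rewrite !linear_sum; apply: eq_bigr => i _; apply: (fg i); apply: Uus.
Qed.

(** On an eigenvector v of g, the relation only requires f to act by the inverse
    eigenvalue up to a correction u in the neighbouring eigenspace of g. *)
Lemma qweyl_rel_at (t c : F) (f g : 'End(V)) v u : t != 0 -> c != 0 ->
  f v - c^-1 *: v = u -> g v = c *: v -> g u = (t^-1 * c) *: u ->
  tw t f g v = ((1 - t) *: (1 : 'End(V))) v.
Proof.
move=> t0 c0 fv gv gu.
have fvE : f v = c^-1 *: v + u by rewrite -fv addrC subrK.
rewrite /tw add_lfunE opp_lfunE !scale_lfunE !end_mulE end_oneE gv linearZ /=.
rewrite fvE [g (_ + _)]linearD /= [g (_ *: _)]linearZ /= gv gu.
rewrite !scalerDr !scalerA mulfV // divfK // mulVKf // scale1r.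
by rewrite scalerBl scale1r opprD addrACA subrr addr0.
Qed.

End DiagonalOperators.

Section SplitOperator.

Variables (F : fieldType) (V : vectType F) (q : F).
Hypothesis q0 : q != 0.

(** The operator a with eigenvalue q^(d-2i) on the i-th split part: X lowers the
    index and Y raises it, which are the two cases of [qweyl_rel_at]. *)
Lemma exists_split_operator (X y Y : 'End(V)) d e A B :
  X * y = 1 -> y * X = 1 -> irreducible_pair X Y ->
  weighted_flag q d A y Y -> weighted_flag q e B Y X ->
  d = e /\ exists a : 'End(V), [/\ has_qspectrum q d a,
    qweyl_rel (q ^- 2) X a & qweyl_rel (q ^- 2)^-1 Y a].
Proof.
move=> Xy yX irr flagA flagB.
have de := split_diameters q0 Xy yX irr flagA flagB; split=> //.
have decC := split_decomposition q0 Xy yX irr flagA flagB.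
have [a aC] := decomposition_diagonal (fun i => qweight q d i) decC.
have aC' n v : (n <= d)%N -> v \in split_part A B d n ->
    a v = qweight q d n *: v.
  by move=> nd; apply: (aC (Ordinal (nd : (n < d.+1)%N))).
have p0 : q ^- 2 != 0 by rewrite invr_eq0 expf_neq0.
exists a; split.
- exact: decomposition_qspectrum decC aC.
- apply: (decomposition_ext decC) => -[i /= id] v Cv.
  have ilen : (i <= d)%N := id.
  apply: (qweyl_rel_at p0 (qweight_neq0 q0 d i) (erefl _) (aC' _ _ ilen Cv)).
  have := split_part_down q0 Xy yX flagA flagB ilen Cv; set u := _ - _.
  case: i id ilen {Cv} @u => [|i] id ilen u.
    by rewrite (wflag0 flagA) cap0v memv0 => /eqP->; rewrite linear0 scaler0.
  move=> Cu; rewrite (aC' i) //; last exact: ltnW.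
  by rewrite qweightS // mulKf.
apply: (decomposition_ext decC) => -[i /= id] v Cv.
have ilen : (i <= d)%N := id.
apply: (qweyl_rel_at (invr_neq0 p0) (qweight_neq0 q0 d i) (erefl _)
          (aC' _ _ ilen Cv)).
have := split_part_up flagA flagB ilen Cv; rewrite -de qweight_rev //.
rewrite invrK; set u := _ - _ => Cu; move: (ilen).
rewrite leq_eqVlt => /predU1P[iE | ilt].
  move: Cu; rewrite iE (split_part_last _ flagB) memv0 => /eqP->.
  by rewrite linear0 scaler0.
by rewrite (aC' i.+1) // qweightS.
Qed.

End SplitOperator.

(** * Relations forced by irreducibility *)

Section ForcedRelations.

Variables (F : fieldType) (V : vectType F) (p : F).
Hypotheses (p0 : p != 0) (p_not_root1 : forall n, (0 < n)%N -> p ^+ n != 1).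
Variables (k k' L L' : 'End(V)).
Hypotheses (kk' : k * k' = 1) (k'k : k' * k = 1).
Hypotheses (LL' : L * L' = 1) (L'L : L' * L = 1).
Hypotheses (V_gt0 : (0 < \dim {:V})%N) (irr : irreducible_pair k L).
Implicit Types (a b x w : 'End(V)).

Let pV0 : p^-1 != 0. Proof. by rewrite invr_eq0. Qed.

Let pV_not_root1 n : (0 < n)%N -> p^-1 ^+ n != 1.
Proof. by move=> n0; rewrite exprVn invr_eq1 p_not_root1. Qed.

Let pV2_not_root1 n : (0 < n)%N -> (p^-1 * p^-1) ^+ n != 1.
Proof. by move=> n0; rewrite -expr2 -exprM pV_not_root1 // muln_gt0. Qed.

(** The constants cancel in the difference a - b, which therefore commutes with k
    and with L up to the scalars p and p^-1. *)
Lemma qweyl_pair_unique a b :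
  qweyl_rel p k a -> qweyl_rel p^-1 L a ->
  qweyl_rel p k b -> qweyl_rel p^-1 L b -> a = b.
Proof.
move=> ka La kb Lb; apply/eqP; rewrite -subr_eq0; apply/eqP.
apply: (quasi_central_eq0 V_gt0 irr LL' p0 pV0 pV_not_root1).
  by rewrite twB ka kb subrr.
by rewrite twB La Lb subrr.
Qed.

Lemma qweyl_consecutive a b :
  qweyl_rel p k a -> qweyl_rel p^-1 L a ->
  qweyl_rel p^-1 k b -> qweyl_rel p L' b -> qweyl_rel p a b.
Proof.
move=> ka La kb L'b; apply/eqP; rewrite -subr_eq0; apply/eqP.
have pV2 := mulf_neq0 pV0 pV0.
apply: (quasi_central_eq0 V_gt0 irr LL' (oner_neq0 F) pV2) => //.
  exact: tw_qweyl_defect_source.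
exact: tw_qweyl_defect_target (tw_inverse p0 L'L LL' L'b).
Qed.

Lemma qserre_opposite x w :
  qweyl_rel p k x -> qweyl_rel p^-1 L x ->
  qweyl_rel p k' w -> qweyl_rel p^-1 L' w -> serre_op p x w = 0.
Proof.
move=> kx Lx k'w L'w.
have [p2 pV2] := (mulf_neq0 p0 p0, mulf_neq0 pV0 pV0).
apply: (quasi_central_eq0 V_gt0 irr LL' p2 pV2) => //.
  exact: tw_serre_op kx (tw_inverse p0 k'k kk' k'w).
rewrite -serre_opC; apply: tw_serre_op Lx _ => //.
exact: tw_inverse pV0 L'L LL' L'w.
Qed.

End ForcedRelations.

(** * Representations of presented algebras *)

Section Representations.

Variables (F : fieldType) (V : vectType F) (X : Type).
Variable rels : algterm F X -> algterm F X -> Prop.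
Implicit Types (g : X -> 'End(V)) (rho : presalg rels -> 'End(V)).

Fixpoint term_eval g (s : algterm F X) : 'End(V) :=
  match s with
  | TGen x => g x
  | TZero => 0
  | TOne => 1
  | TOpp s => - term_eval g s
  | TAdd s t => term_eval g s + term_eval g t
  | TMul s t => term_eval g s * term_eval g t
  | TScale c s => c *: term_eval g s
  end.

Lemma term_eval_cong g :
  (forall s t, rels s t -> term_eval g s = term_eval g t) ->
  forall s t, algcong rels s t -> term_eval g s = term_eval g t.
Proof.
move=> grel s t; elim=> //=.
- by move=> u v w _ -> _ ->.
- by move=> u v _ ->.
- by move=> u u' v v' _ -> _ ->.
- by move=> u u' v v' _ -> _ ->.
- by move=> c u u' _ ->.
- by move=> *; rewrite addrA.
- by move=> *; rewrite addrC.
- by move=> *; rewrite add0r.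
- by move=> *; rewrite addNr.
- by move=> *; rewrite mulrA.
- by move=> *; rewrite mul1r.
- by move=> *; rewrite mulr1.
- by move=> *; rewrite mulrDl.
- by move=> *; rewrite mulrDr.
- by move=> *; rewrite scalerA.
- by move=> *; rewrite scale1r.
- by move=> *; rewrite scalerDr.
- by move=> *; rewrite scalerDl.
- by move=> *; rewrite end_scalerAl.
- by move=> *; rewrite end_scalerAr.
Qed.

Definition pres_rep g (a : presalg rels) : 'End(V) := term_eval g (repr a).

Definition representation rho :=
  [/\ linear rho, rho 1 = 1 & forall a b, rho (a * b) = rho a * rho b].

Lemma pres_rep_class g s :
  (forall s t, rels s t -> term_eval g s = term_eval g t) ->
  pres_rep g (pres_class rels s) = term_eval g s.
Proof. by move=> grel; apply/(term_eval_cong grel)/repr_class. Qed.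

Lemma pres_rep_representation g :
  (forall s t, rels s t -> term_eval g s = term_eval g t) ->
  representation (pres_rep g).
Proof.
move=> grel; split=> [c|| ].
- elim/pres_class_ind=> s; elim/pres_class_ind=> t.
  rewrite [in LHS]/GRing.scale [in LHS]/GRing.add /= !pres_opE.
  by rewrite !pres_rep_class.
- exact: pres_rep_class.
elim/pres_class_ind=> s; elim/pres_class_ind=> t.
by rewrite [in LHS]/GRing.mul /= !pres_opE !pres_rep_class.
Qed.

Lemma representation_eval rho s : representation rho ->
  rho (pres_class rels s) = term_eval (fun x => rho (pres_gen rels x)) s.
Proof.
move=> [rho_lin rho1 rhoM].
have rhoD a b : rho (a + b) = rho a + rho b.
  by rewrite -[a]scale1r rho_lin !scale1r.
have rho0 : rho 0 = 0 by apply: (addrI (rho 0)); rewrite -rhoD !addr0.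
have rhoZ c a : rho (c *: a) = c *: rho a.
  by rewrite -[c *: a]addr0 rho_lin rho0 addr0.
have rhoN a : rho (- a) = - rho a by rewrite -scaleN1r rhoZ scaleN1r.
elim: s => //= [s <-|s <- t <-|s <- t <-|c s <-].
- by rewrite -rhoN; congr rho; rewrite -pres_oppE.
- by rewrite -rhoD; congr rho; rewrite -pres_addE.
- by rewrite -rhoM; congr rho; rewrite -pres_mulE.
by rewrite -rhoZ; congr rho; rewrite -pres_scaleE.
Qed.

Lemma representation_rel rho s t : representation rho -> rels s t ->
  term_eval (fun x => rho (pres_gen rels x)) s
  = term_eval (fun x => rho (pres_gen rels x)) t.
Proof.
move=> rep st; rewrite -!representation_eval //; congr rho.
exact/pres_class_eq/cong_rel.
Qed.

Lemma representation_ext rho1 rho2 :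
  representation rho1 -> representation rho2 ->
  (forall x, rho1 (pres_gen rels x) = rho2 (pres_gen rels x)) -> rho1 = rho2.
Proof.
move=> rep1 rep2 gen12; apply/funext; elim/pres_class_ind=> s.
by rewrite !representation_eval //; congr (term_eval _ s); apply/funext.
Qed.

End Representations.

(** * The module structure on the tetrahedron *)

Section TetrahedronModule.

Variables (F : fieldType) (V : vectType F) (q : F).
Hypothesis q0 : q != 0.
Hypothesis q_not_root1 : forall n : nat, (0 < n)%N -> q ^+ n != 1.
Hypothesis V_gt0 : (0 < \dim {:V})%N.
Local Notation p := (q ^- 2).

Let p0 : p != 0. Proof. by rewrite invr_eq0 expf_neq0. Qed.

Let p_not_root1 n : (0 < n)%N -> p ^+ n != 1.
Proof.
by move=> n0; rewrite exprVn invr_eq1 -exprM q_not_root1 // muln_gt0.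
Qed.

Lemma qdiff_neq0 : q - q^-1 != 0.
Proof.
rewrite subr_eq0; apply: contra (q_not_root1 (ltn0Sn 1)) => /eqP qV.
by rewrite expr2 {2}qV mulfV.
Qed.

Lemma qnat3E : qnat q 3 = 1 + p + p^-1.
Proof.
rewrite /qnat; apply: (mulIf qdiff_neq0); rewrite mulfVK ?qdiff_neq0 //.
by field; rewrite q0 oner_neq0.
Qed.

Lemma qweylE (x y : 'End(V)) :
  (q - q^-1)^-1 *: (q *: (x * y) - q^-1 *: (y * x)) = 1 <-> qweyl_rel p x y.
Proof.
have -> : q *: (x * y) - q^-1 *: (y * x) = q *: tw p x y.
  by rewrite /tw scalerBr scalerA; congr (_ - _ *: _); field.
have pE : q - q^-1 = q * (1 - p) by field.
have p1 : 1 - p != 0 by have := qdiff_neq0; rewrite pE mulf_eq0 negb_or q0.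
rewrite scalerA pE invfM mulrAC mulVf // mul1r /qweyl_rel.
split=> [<-|->]; first by rewrite scalerA mulfV // scale1r.
by rewrite scalerA mulVf // scale1r.
Qed.

Variables (y : 'Z_4 -> 'End(V)) (deg : 'Z_4 -> nat).
Hypothesis yV : forall r, y r * y (r + 2%:R) = 1.
Hypothesis y_irr : irreducible_pair (y 0) (y 1).
Hypothesis y_filtered : forall r,
  filtered_decomposition q (deg r) (y r) (y (r + 1)) (y (r + 3%:R)).

Lemma Z4_addK (r : 'Z_4) : [/\ r + 1 + 1 = r + 2%:R, r + 1 + 2%:R = r + 3%:R,
  r + 2%:R + 2%:R = r & r + 3%:R + 2%:R = r + 1].
Proof. by split; rewrite -?addrA; apply/val_inj; case: r => [[|[|[|[|]]]]]. Qed.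

Lemma Z4_shift (r s c : 'Z_4) : s - r = c -> s = r + c.
Proof. by move=> <-; rewrite addrC subrK. Qed.

Lemma qtet_arc2 (r : 'Z_4) : qtet_arc r (r + 2%:R).
Proof. by rewrite /qtet_arc addrC addKr eqxx orbT. Qed.

Lemma Z4_ind (P : 'Z_4 -> Prop) :
  P 0 -> (forall r, P r -> P (r + 1)) -> forall r, P r.
Proof.
move=> P0 PS r; rewrite -[r]natr_Zp.
by elim: (val r) => // n IHn; rewrite mulrSr; apply: PS.
Qed.

Let yV' r : y (r + 2%:R) * y r = 1.
Proof. by have := yV (r + 2%:R); have [_ _ -> _] := Z4_addK r. Qed.

(** Each of K, Ks may be replaced by its inverse because an invertible operator and
    its inverse have the same invariant subspaces. *)
Lemma tetrahedron_irreducible r : irreducible_pair (y (r + 2%:R)) (y (r + 1)).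
Proof.
apply: (irreducible_pair_inverse (yV r) (yV' r)); elim/Z4_ind: r => [|r IHr].
  by rewrite add0r.
have [-> _ _ _] := Z4_addK r.
exact/irreducible_pairC/(irreducible_pair_inverse (yV r) (yV' r)).
Qed.

Let split_operator_at r : deg r = deg (r + 1) /\ exists a : 'End(V),
  [/\ has_qspectrum q (deg r) a, qweyl_rel p (y (r + 2%:R)) a
    & qweyl_rel p^-1 (y (r + 1)) a].
Proof.
have [A flagA] := weighted_flag_of_decomposition q0 (y_filtered r).
have [B] := weighted_flag_of_decomposition q0 (y_filtered (r + 1)).
have [-> _ _ _] := Z4_addK r => flagB.
have irr := @tetrahedron_irreducible r.
exact: exists_split_operator (yV' r) (yV r) irr flagA flagB.
Qed.

Lemma tetrahedron_edges : exists a : 'Z_4 -> 'End(V), forall r,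
  [/\ has_qspectrum q (deg 0) (a r), has_qspectrum q (deg 0) (y r),
    qweyl_rel p (y (r + 2%:R)) (a r) & qweyl_rel p^-1 (y (r + 1)) (a r)].
Proof.
have degE r : deg r = deg 0.
  by elim/Z4_ind: r => // r <-; have [] := split_operator_at r.
suff /choice[a aP] : forall r, exists a : 'End(V),
    [/\ has_qspectrum q (deg 0) a, has_qspectrum q (deg 0) (y r),
        qweyl_rel p (y (r + 2%:R)) a & qweyl_rel p^-1 (y (r + 1)) a] by exists a.
move=> r.
have [_ [a [sa ka La]]] := split_operator_at r.
exists a; split; rewrite -?(degE r) //.
have [U decU yU] := y_filtered r.
by apply: (decomposition_qspectrum decU) => i v; case: (yU i) => + _ _; apply.
Qed.

Variable a : 'Z_4 -> 'End(V).
Hypothesis a_source : forall r, qweyl_rel p (y (r + 2%:R)) (a r).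
Hypothesis a_target : forall r, qweyl_rel p^-1 (y (r + 1)) (a r).

Definition qtet_gen (rs : qtet_index) : 'End(V) :=
  if (val rs).2 - (val rs).1 == 2%:R then y (val rs).1 else a (val rs).1.

Lemma qtet_gen_opposite r s (rs : qtet_arc r s) :
  s - r = 2%:R -> qtet_gen (qtet_index_of rs) = y r.
Proof. by rewrite /qtet_gen /= => ->; rewrite eqxx. Qed.

Lemma qtet_gen_consecutive r s (rs : qtet_arc r s) :
  s - r = 1 -> qtet_gen (qtet_index_of rs) = a r.
Proof. by rewrite /qtet_gen /= => ->. Qed.

Lemma qtet_gen_rel s t :
  qtet_rel q s t -> term_eval qtet_gen s = term_eval qtet_gen t.
Proof.
case=> {s t} [r s rs sr sr2|r s t rs st|r s t u rs tu sr1 ts1 ut1] /=.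
- rewrite !qtet_gen_opposite //; first by rewrite (Z4_shift sr2) yV.
  by rewrite (Z4_shift sr2) opprD addNKr; apply/val_inj.
- have [_ r12 r22 _] := Z4_addK r.
  rewrite !inE !xpair_eqE => /or3P[] /andP[/eqP sr /eqP ts]; apply/qweylE.
  + rewrite !qtet_gen_consecutive // (Z4_shift sr).
    have [r11 _ _ r32] := Z4_addK r.
    apply: (qweyl_consecutive p0 p_not_root1 _ _ V_gt0
              (@tetrahedron_irreducible r) (L' := y (r + 3%:R))) => //.
    * by rewrite -r12 yV.
    * by rewrite -r12 yV'.
    * by rewrite -r11; apply: a_target.
    by rewrite -r12; apply: a_source.
  + rewrite qtet_gen_consecutive // qtet_gen_opposite // (Z4_shift sr).
    by rewrite -[p]invrK; apply: qweyl_relC (a_target r); rewrite invr_eq0.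
  rewrite qtet_gen_opposite // qtet_gen_consecutive // (Z4_shift sr).
  by rewrite -{1}r22; apply: a_source.
rewrite !qtet_gen_consecutive // -[RHS](_ : serre_op p (a r) (a t) = 0).
  by rewrite serre_opE // qnat3E.
have [r11 r12 r22 r32] := Z4_addK r.
have tE : t = r + 2%:R by rewrite (Z4_shift ts1) (Z4_shift sr1).
rewrite tE.
apply: (qserre_opposite p0 p_not_root1 _ _ _ _ V_gt0
          (@tetrahedron_irreducible r) (k' := y r) (L' := y (r + 3%:R))) => //.
- by rewrite -r12 yV.
- by rewrite -r12 yV'.
- by rewrite -{1}r22; apply: a_source.
have <- : r + 2%:R + 1 = r + 3%:R.
  by rewrite -addrA; congr (_ + _); apply/val_inj.
exact: a_target.
Qed.

Lemma qtet_index_eq r s (rs : qtet_arc r s) r' s' (rs' : qtet_arc r' s') :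
  r = r' -> s = s' -> qtet_index_of rs = qtet_index_of rs'.
Proof. by move=> rE sE; apply/val_inj; rewrite /= rE sE. Qed.

(** Relation (i) makes x_20 and x_31 the inverses of x_02 and x_13. *)
Lemma qtet_representation_opposite (rho : qtet q -> 'End(V)) :
  representation rho ->
  rho (qtet_x q (isT : qtet_arc 0 2%:R)) = y 0 ->
  rho (qtet_x q (isT : qtet_arc 1 3%:R)) = y 1 ->
  forall r s (rs : qtet_arc r s), s = r + 2%:R -> rho (qtet_x q rs) = y r.
Proof.
move=> rep rho02 rho13.
pose forced r := forall s (rs : qtet_arc r s),
  s = r + 2%:R -> rho (qtet_x q rs) = y r.
have forced0 : forced 0.
  move=> s rs sE; rewrite -rho02; congr (rho (pres_gen _ _)).
  by apply: qtet_index_eq; rewrite ?sE ?add0r.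
have forced1 : forced 1.
  move=> s rs sE; rewrite -rho13; congr (rho (pres_gen _ _)).
  exact: qtet_index_eq.
have step r : forced r -> forced (r + 2%:R).
  have [_ _ r22 _] := Z4_addK r => IH s rs; rewrite r22 => sE; subst s.
  have := representation_rel rep (qtet_rel_inv q (qtet_arc2 r) rs _).
  rewrite /= -!/(qtet_x _ _) IH // => /(_ _)/(congr1 ( *%R (y (r + 2%:R)))).
  by rewrite mulrA yV' mul1r mulr1; apply; rewrite addrC addKr.
suff forced_all r : forced r by move=> r s rs; apply: forced_all.
have [->|->|->|->] : [\/ r = 0, r = 1, r = 0 + 2%:R | r = 1 + 2%:R]; last 2 first.
- exact: step.
- exact: step.
- by case: r => [[|[|[|[|//]]]] r4];
    [constructor 1|constructor 2|constructor 3|constructor 4]; apply/val_inj.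
- exact: forced0.
exact: forced1.
Qed.

(** The images of the x_(r,r+1) are forced by [qweyl_pair_unique], applied to the
    relations (ii) that link x_(r,r+1) to x_(r+2,r) and to x_(r+1,r+3). *)
Lemma qtet_representation_gen (rho : qtet q -> 'End(V)) : representation rho ->
  rho (qtet_x q (isT : qtet_arc 0 2%:R)) = y 0 ->
  rho (qtet_x q (isT : qtet_arc 1 3%:R)) = y 1 ->
  forall rs, rho (pres_gen (qtet_rel q) rs) = qtet_gen rs.
Proof.
move=> rep rho02 rho13.
have opp := qtet_representation_opposite rep rho02 rho13.
case=> [[r s] /= rs]; rewrite -/(qtet_index_of _) -/(qtet_x _ _).
case/orP: (rs) => /eqP srE; last first.
  by rewrite [RHS]qtet_gen_opposite //; apply/opp/Z4_shift.
rewrite [RHS]qtet_gen_consecutive //.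
have sE := Z4_shift srE; subst s.
have [r11 r12 r22 r32] := Z4_addK r.
have r2r : r - (r + 2%:R) = 2%:R by rewrite opprD addNKr; apply/val_inj.
apply: (qweyl_pair_unique p0 p_not_root1 _ V_gt0
          (@tetrahedron_irreducible r) (L' := y (r + 3%:R))) => //.
- by rewrite -r12 yV.
- have arc20 : qtet_arc (r + 2%:R) r by rewrite /qtet_arc r2r eqxx orbT.
  have := representation_rel rep (qtet_rel_qweyl q arc20 rs _).
  rewrite /= -!/(qtet_x _ _) (opp _ _ arc20) ?r22 // => H.
  by apply/qweylE/H; rewrite r2r srE.
have arc13 := qtet_arc2 (r + 1).
have := representation_rel rep (qtet_rel_qweyl q rs arc13 _).
rewrite /= -!/(qtet_x _ _) (opp _ _ arc13) // => H; apply: qweyl_relC => //.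
by apply/qweylE/H; rewrite srE [r + 1 + _]addrC addrK.
Qed.

End TetrahedronModule.

Unset Implicit Arguments.

Theorem theorem4p6 (F : closedFieldType) (q : F)
    (q_neq0 : q != 0)
    (q_not_root1 : forall n : nat, (0 < n)%N -> q ^+ n != 1)
    (V : vectType F) (V_gt0 : (0 < \dim (fullv : {vspace V}))%N)
    (K Ks : 'End(V)) (KKs : q_inverting_pair q K Ks) :
  let acts_as (rho : qtet q -> 'End(V)) :=
    [/\ module_structure rho,
        rho (qtet_x q (isT : qtet_arc 0 2)) = K
      & rho (qtet_x q (isT : qtet_arc 1 3)) = Ks] in
  (exists! rho : qtet q -> 'End(V), acts_as rho) /\
  (forall rho : qtet q -> 'End(V), acts_as rho ->
     irreducible_module rho /\ qtet_type rho 1).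
Proof.
move=> acts_as; case: KKs => -[Kbij Ksbij].
move=> [d [U [decU KU]]] [d' [U' [decU' KsU']]] irrK.
have inv_bij (f : 'End(V)) :
    bijective f -> f * f^-1%VF = 1 /\ f^-1%VF * f = 1.
  move/bij_inj/lker0P => kf.
  by rewrite [_ * _]lker0_compfV // [_ * _]lker0_compVf.
have [[KKV KVK] [KsKsV KsVKs]] := (inv_bij K Kbij, inv_bij Ks Ksbij).
have eigen (f : 'End(V)) c W :
    ((f - c *: \1%VF) @: W = 0)%VS -> forall v, v \in W -> f v = c *: v.
  move=> fW v Wv; apply/eqP; rewrite -subr_eq0 -memv0 -fW.
  by have := memv_img (f - c *: \1%VF)%VF Wv; rewrite !lfun_simp.
have filK : filtered_decomposition q d K Ks Ks^-1%VF.
  by exists U => // i; have [/eigen Ki Ksi KsVi] := KU i.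
have filKs : filtered_decomposition q d' Ks K^-1%VF K.
  by exists U' => // i; have [/eigen Ksi Ki KVi] := KsU' i.
pose y (r : 'Z_4) : 'End(V) := nth 0 [:: K; Ks; K^-1%VF; Ks^-1%VF] r.
(* That d = d' is not assumed; it comes out of [split_diameters]. *)
pose deg (r : 'Z_4) := if odd r then d' else d.
have y_inv r : y r * y (r + 2%:R) = 1.
  by case: r => [[|[|[|[|//]]]] r4].
have y_fil r :
    filtered_decomposition q (deg r) (y r) (y (r + 1)) (y (r + 3%:R)).
  case: r => [[|[|[|[|//]]]] r4] //.
    exact: (filtered_decomposition_rev q_neq0 KVK filK).
  exact: (filtered_decomposition_rev q_neq0 KsVKs filKs).
have y_irr : irreducible_pair (y 0) (y 1) by exact: irrK.
have [a aP] := tetrahedron_edges q_neq0 y_inv y_irr y_fil.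
have a_source r : qweyl_rel (q ^- 2) (y (r + 2%:R)) (a r) by case: (aP r).
have a_target r : qweyl_rel (q ^- 2)^-1 (y (r + 1)) (a r) by case: (aP r).
have gen_rel :=
  qtet_gen_rel q_neq0 q_not_root1 V_gt0 y_inv y_irr a_source a_target.
have rep0 := pres_rep_representation gen_rel.
have gen_rho rho : acts_as rho ->
    forall rs, rho (pres_gen (qtet_rel q) rs) = qtet_gen y a rs.
  case=> rep rhoK rhoKs.
  exact: (qtet_representation_gen q_neq0 q_not_root1 V_gt0 y_inv y_irr).
split.
  exists (pres_rep (qtet_gen y a)); split.
    by split=> //; rewrite [LHS](pres_rep_class _ gen_rel).
  move=> rho [rep rhoK rhoKs]; apply: (representation_ext rep0 rep) => rs.
  by rewrite [RHS]gen_rho // [LHS](pres_rep_class (TGen rs) gen_rel).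
move=> rho rho_acts; have [_ rhoK rhoKs] := rho_acts; split.
  split; first by rewrite -dimv_eq0 -lt0n.
  by move=> W W_stable; apply: irrK; [rewrite -rhoK|rewrite -rhoKs].
exists (deg 0); split=> [|r s rs]; first by left.
rewrite [rho _]gen_rho //.
suff [? spec] : has_qspectrum q (deg 0) (qtet_gen y a (qtet_index_of rs)).
  by split=> // c; rewrite spec; split=> -[i id ->]; exists i; rewrite ?mul1r.
by rewrite /qtet_gen; case: eqP => _; case: (aP r).
Qed.
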